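(* Let $\mathcal{B}$ be a separable Banach space. Then there exists a separable Hilbert space $\mathcal{H}_2$ such that $\mathcal{B} \subset \mathcal{H}_2$ as a continuous dense embedding.
   Context: ''$X \subset Y$ as a continuous dense embedding'' means that there is an injective continuous linear map $X \to Y$ (regarded as an inclusion) whose image is dense in $Y$. The Banach space is over $\mathbb{R}$ or $\mathbb{C}$, and the Hilbert space is over the same scalar field. *)

(* Defs.v *)
From HB Require Import structures.
From mathcomp Require Import all_boot all_order all_algebra.
From mathcomp Require Export sesquilinear complex.
From mathcomp Require Import all_classical all_reals all_analysis.

Set Implicit Arguments.
Unset Strict Implicit.
Unset Printing Implicit Defensive.

Import Order.TTheory GRing.Theory Num.Theory.
Import numFieldNormedType.Exports.
Local Open Scope classical_set_scope.
Local Open Scope ring_scope.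

Definition separable_space (T : topologicalType) : Prop :=
  exists2 D : set T, countable D & dense D.

(* The Banach space H is a Hilbert space: its norm comes from an inner
   product, linear in the first argument and conj-linear in the second; conj
   is the conjugation of K (idfun for real scalars, conjc for complex ones).
   The norm of a normedModType K takes its values in K. *)
Definition is_hilbert (K : numFieldType) (conj : K -> K)
    (H : completeNormedModType K) : Prop :=
  exists dot : {dot H for conj}, forall x : H, `|x| ^+ 2 = dot x x.

Definition continuous_dense_embedding (K : numFieldType)
    (X Y : normedModType K) (f : {linear X -> Y}) : Prop :=
  [/\ injective f, continuous f & dense (range f)].

(* Main.v *)
Require Import Defs.
From HB Require Import structures.
From mathcomp Require Import all_boot all_order all_algebra.
From mathcomp Require Import all_classical all_reals all_analysis.
From mathcomp Require Import ring lra.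

Import Order.TTheory GRing.Theory Num.Theory.
Import numFieldNormedType.Exports.
Local Open Scope classical_set_scope.
Local Open Scope ring_scope.

Set Implicit Arguments.
Unset Strict Implicit.

(* By Hahn-Banach, each point of a countable dense subset of [B] has a norming
   functional; the resulting functionals [f n], of norm at most 2, separate the
   points of [B].  Hence [x |-> (2^-n * f n x)_n] is an injective bounded map
   from [B] into l^2, and the Hilbert space is the closure of its range. *)

(** Closing the range, instead of working in all of l^2, makes density hold by construction and lets
    separability pass from [B] to the Hilbert space through the map itself. The space l^2 is never
    built: membership in the closure and its norm are expressed by Euclidean norms of the first [n]
    coordinates, bounded uniformly in [n]. The norm bound is 2 and not 1 because Hahn-Banach is
    applied over the reals only. A complex functional is rebuilt from its real part [g], and its
    modulus at [x] is estimated crudely by [|g x| + |g (i x)|]. Any uniform bound would do, since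
    the weights [2^-n] are summable. *)

(** * Hahn-Banach for real functionals, by minimal sublinear functionals *)

Section HahnBanach.
Variables (R : realType) (K : numFieldType) (inj : {rmorphism R -> K}).
Variable V : lmodType K.

(** Only real scalars act, through [inj], so a complex space is treated as a real one. Homogeneity
    is asked as an inequality, the form that passes to infima; applying it to [t^-1] gives back the
    equality. *)
Definition sublinear (p : V -> R) : Prop :=
  (forall x y, p (x + y) <= p x + p y) /\
  (forall t x, 0 <= t -> p (inj t *: x) <= t * p x).

Lemma sublinear0 p : sublinear p -> p 0 = 0.
Proof.
move=> [pD pZ]; apply/eqP; rewrite eq_le; apply/andP; split.
  by have := pZ 0 0 (lexx _); rewrite scaler0 mul0r.
by have := pD 0 0; rewrite addr0; lra.
Qed.

Lemma sublinear_hom p t x : sublinear p -> 0 <= t -> p (inj t *: x) = t * p x.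
Proof.
move=> sp; rewrite le_eqVlt => /predU1P[<-|t0].
  by rewrite rmorph0 scale0r mul0r sublinear0.
apply/eqP; rewrite eq_le sp.2 ?(ltW t0)//=.
have tn0 : t != 0 by rewrite gt_eqF.
have := sp.2 t^-1 (inj t *: x); rewrite invr_ge0 (ltW t0) => /(_ isT).
by rewrite scalerA -rmorphM mulVf// rmorph1 scale1r ler_pdivlMl.
Qed.

Lemma sublinear_geN p x : sublinear p -> - p (- x) <= p x.
Proof.
move=> sp; have := sp.1 x (- x); rewrite subrr sublinear0//; lra.
Qed.

(** Serves twice: for [slide], and for the lower bound of a chain in Zorn's lemma. The two closure
    conditions say just enough for near-minimizers at [x] and [y] to be combined. *)
Lemma inf_sublinear (F : set (V -> R)) :
    F !=set0 -> (forall x, has_lbound [set f x | f in F]) ->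
    (forall f g x y, F f -> F g -> exists2 h, F h & h (x + y) <= f x + g y) ->
    (forall f t x, F f -> 0 <= t ->
      exists2 h, F h & h (inj t *: x) <= t * f x) ->
  sublinear (fun x => inf [set f x | f in F]).
Proof.
move=> [f0 Ff0] Flb FD FZ.
have Fne x : [set f x | f in F] !=set0 by exists (f0 x), f0.
have infle f x : F f -> inf [set f x | f in F] <= f x.
  by move=> Ff; apply: ge_inf => //; exists f.
split=> [x y|t x t0].
- apply/ler_addgt0Pl => e e0.
  have e20 : 0 < e / 2 by lra.
  have [_ [f Ff <-] fe] := inf_adherent e20 (conj (Fne x) (Flb x)).
  have [_ [g Fg <-] ge] := inf_adherent e20 (conj (Fne y) (Flb y)).
  have [h Fh hfg] := FD f g x y Ff Fg.
  have := infle h (x + y) Fh; lra.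
- move: (t0); rewrite le_eqVlt => /predU1P[<-|tp].
    have [h Fh hf] := FZ f0 0 x Ff0 (lexx _).
    rewrite !mul0r in hf *.
    exact: le_trans (infle h _ Fh) hf.
  rewrite -ler_pdivrMl//; apply: lb_le_inf => // _ [f Ff <-].
  rewrite ler_pdivrMl//; have [h Fh hf] := FZ f t x Ff t0.
  exact: le_trans (infle h _ Fh) hf.
Qed.

(** For sublinear [g], this is the largest sublinear functional below [g] whose value at [- v] is at
    most [- g v]. *)
Definition slide (g : V -> R) (v : V) : V -> R :=
  fun x => inf [set f x | f in [set f | exists2 t, 0 <= t &
    f = fun x => g (x + inj t *: v) - t * g v]].

Lemma slide_lbound g v x : sublinear g ->
  lbound [set f x | f in [set f | exists2 t, 0 <= t &
    f = fun x => g (x + inj t *: v) - t * g v]] (- g (- x)).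
Proof.
move=> sg _ [_ [t t0 ->] <-].
have := sg.1 (x + inj t *: v) (- x).
rewrite [x + _]addrC addrK sublinear_hom//; lra.
Qed.

Lemma sublinear_slide g v : sublinear g -> sublinear (slide g v).
Proof.
move=> sg; apply: inf_sublinear.
- by exists (fun x => g (x + inj 0 *: v) - 0 * g v), 0.
- by move=> x; exists (- g (- x)); exact: slide_lbound.
- move=> _ _ x y [s s0 ->] [t t0 ->].
  exists (fun x => g (x + inj (s + t) *: v) - (s + t) * g v).
    by exists (s + t) => //; rewrite addr_ge0.
  have := sg.1 (x + inj s *: v) (y + inj t *: v).
  rewrite addrACA -scalerDl -rmorphD; lra.
- move=> _ t x [s s0 ->] t0.
  exists (fun x => g (x + inj (t * s) *: v) - (t * s) * g v).
    by exists (t * s) => //; rewrite mulr_ge0.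
  rewrite rmorphM -scalerA -scalerDr sublinear_hom//; lra.
Qed.

Lemma slide_le g v x : sublinear g -> slide g v x <= g x.
Proof.
move=> sg; apply: ge_inf; first by exists (- g (- x)); exact: slide_lbound.
exists (fun x => g (x + inj 0 *: v) - 0 * g v); first by exists 0.
by rewrite rmorph0 scale0r addr0 mul0r subr0.
Qed.

Lemma slideN g v : sublinear g -> slide g v (- v) <= - g v.
Proof.
move=> sg; apply: ge_inf; first by exists (- g (- - v)); exact: slide_lbound.
exists (fun x => g (x + inj 1 *: v) - 1 * g v); first by exists 1.
by rewrite rmorph1 scale1r addNr sublinear0// mul1r sub0r.
Qed.

Lemma minimal_sublinear p : sublinear p ->
  exists g, [/\ sublinear g, forall x, g x <= p x &
    forall h, sublinear h -> (forall x, h x <= g x) -> h = g].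
Proof.
move=> sp; pose P (g : V -> R) := sublinear g /\ forall x, g x <= p x.
pose T := {g | P g}.
have [[g [sg gp]] gmin] : exists t : T,
    forall s : T, `[< forall x, sval s x <= sval t x >] -> s = t.
  (* The order is reversed, so that a maximal element is a minimal functional. *)
  apply: (@Zorn T (fun t s => `[< forall x, sval s x <= sval t x >])).
  - by move=> t; apply/asboolP.
  - move=> r s t /asboolP rs /asboolP st; apply/asboolP => x.
    exact: le_trans (st x) (rs x).
  - move=> [s ps] [t pt] /asboolP st /asboolP ts; apply: eq_exist => /=.
    by apply/funext => x; apply/eqP; rewrite eq_le st ts.
  move=> A Atot; have [[t0 At0]|A0] := pselect (A !=set0); last first.
    by exists (@exist _ P p (conj sp (fun x => lexx _))) => s As; case: A0; exists s.
  pose F : set (V -> R) := [set sval s | s in A].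
  (* Every [s] below [p] satisfies [s x >= - s (- x) >= - p (- x)], so the pointwise infimum of the
     chain is finite. *)
  have Flb x : lbound [set f x | f in F] (- p (- x)).
    move=> _ [_ [s As <-] <-]; have [ss sle] := svalP s.
    by rewrite (le_trans _ (sublinear_geN x ss))// lerN2 sle.
  have sF : sublinear (fun x => inf [set f x | f in F]).
    apply: inf_sublinear.
    + by exists (sval t0), t0.
    + by move=> x; exists (- p (- x)).
    + move=> _ _ x y [s As <-] [t At <-].
      have [/asboolP st|/asboolP ts] := Atot s t As At.
        exists (sval t); first by exists t.
        by rewrite (le_trans ((svalP t).1.1 _ _))// lerD2r st.
      exists (sval s); first by exists s.
      by rewrite (le_trans ((svalP s).1.1 _ _))// lerD2l ts.
    + move=> _ t x [s As <-] t_ge0; exists (sval s); first by exists s.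
      exact: (svalP s).1.2.
  have Fle s x : A s -> inf [set f x | f in F] <= sval s x.
    move=> As; apply: ge_inf; first by exists (- p (- x)).
    by exists (sval s) => //; exists s.
  have Fp x : inf [set f x | f in F] <= p x.
    exact: le_trans (Fle t0 x At0) ((svalP t0).2 x).
  exists (@exist _ P _ (conj sF Fp)) => s As; apply/asboolP => x /=.
  exact: Fle.
exists g; split=> // h sh hg.
have hp x : h x <= p x by rewrite (le_trans (hg x)).
by have /(congr1 sval) := gmin (@exist _ P h (conj sh hp)) (asboolT hg).
Qed.

(* A minimal sublinear functional [g] is linear: sliding it along [v] gives a
   smaller one, so [g = slide g v], and [slideN] reads [g (- v) <= - g v]. *)
Theorem hahn_banach p v : sublinear p ->
  exists g : V -> R, [/\ forall x y, g (x + y) = g x + g y,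
    forall t x, g (inj t *: x) = t * g x,
    forall x, g x <= p x & g v = p v].
Proof.
(* Minimizing below [slide p v] rather than [p] yields [g (- v) <= - p v], which becomes [g v = p v]
   once [g] is odd. *)
move=> sp; have [g [sg gq gmin]] := minimal_sublinear (sublinear_slide v sp).
have gN x : g (- x) = - g x.
  apply/eqP; rewrite eq_le; apply/andP; split.
    rewrite -[in leLHS](gmin _ (sublinear_slide x sg)) ?slideN//.
    by move=> y; exact: slide_le.
  by have := sublinear_geN (- x) sg; rewrite opprK.
have gp x : g x <= p x by rewrite (le_trans (gq x))// slide_le.
exists g; split => //.
- move=> x y; apply/eqP; rewrite eq_le sg.1/=.
  have := sg.1 (- x) (- y); rewrite -opprD !gN; lra.
- move=> t x; have [t0|t0] := leP 0 t; first by rewrite sublinear_hom.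
  have := @sublinear_hom g (- t) x sg; rewrite oppr_ge0 (ltW t0) => /(_ isT).
  by rewrite rmorphN scaleNr gN mulNr => /oppr_inj.
- apply/eqP; rewrite eq_le gp/=.
  by have := gq (- v); have := slideN v sp; rewrite gN; lra.
Qed.

End HahnBanach.

(* What the proof uses of a field [K] of real or complex scalars; [embed] embeds
   the reals, [modulus] is the norm of [K] read in [R], and [unit_i] is 1 for
   the reals and the imaginary unit for the complex numbers. *)
Record scalars (R : realType) (K : numFieldType) := Scalars {
  embed : {rmorphism R -> K};
  modulus : K -> R;
  cj : {rmorphism K -> K};
  unit_i : K;
  norm_modulus : forall z, `|z| = embed (modulus z);
  embed_ge0 : forall t, (0 <= embed t) = (0 <= t);
  mul_cj : forall z, z * cj z = `|z| ^+ 2;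
  cjK : involutive cj;
  modulus_unit_i : modulus unit_i = 1;
  scalars_complete : forall w : nat -> K,
    (forall e, 0 < e -> exists N, forall m n, (N <= m)%N -> (N <= n)%N ->
      modulus (w m - w n) <= e) ->
    exists l, modulus (w n - l) @[n --> \oo] --> (0 : R);
  real_functional_lift : forall (V : lmodType K) (g : V -> R),
    (forall x y, g (x + y) = g x + g y) ->
    (forall t x, g (embed t *: x) = t * g x) ->
    exists f : {linear V -> K^o}, forall x,
      `|g x| <= modulus (f x) <= `|g x| + `|g (unit_i *: x)| }.

(** * Modulus and convergence of scalar sequences *)

Section Scalars.
Variables (R : realType) (K : numFieldType) (s : scalars R K).
Local Notation inj := (embed s).
Local Notation abs := (modulus s).
Local Notation cj := (cj s).
Local Notation normE := (norm_modulus s).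
Local Notation inj_ge0 := (embed_ge0 s).
Local Notation mul_cj := (mul_cj s).

Lemma ler_inj t u : (inj t <= inj u) = (t <= u).
Proof. by rewrite -subr_ge0 -rmorphB inj_ge0 subr_ge0. Qed.

Lemma ltr_inj t u : (inj t < inj u) = (t < u).
Proof. by rewrite !lt_neqAle ler_inj fmorph_eq. Qed.

Lemma modulus_ge0 z : 0 <= abs z.
Proof. by rewrite -inj_ge0 -normE. Qed.

Lemma modulus_inj t : abs (inj t) = `|t|.
Proof.
apply: (fmorph_inj inj); rewrite -normE.
have [t0|t0] := ger0P t; first by rewrite ger0_norm ?inj_ge0.
by rewrite -normrN -rmorphN ger0_norm ?inj_ge0 ?oppr_ge0 ?ltW.
Qed.

Lemma modulus0 : abs 0 = 0.
Proof. by rewrite -(rmorph0 inj) modulus_inj normr0. Qed.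

Lemma modulus_eq0 z : abs z = 0 -> z = 0.
Proof. by move=> z0; apply/eqP; rewrite -normr_eq0 normE z0 rmorph0. Qed.

Lemma ler_modulusD z w : abs (z + w) <= abs z + abs w.
Proof. by rewrite -ler_inj rmorphD/= -!normE ler_normD. Qed.

Lemma modulusM z w : abs (z * w) = abs z * abs w.
Proof. by apply: (fmorph_inj inj); rewrite rmorphM/= -!normE normrM. Qed.

Lemma modulusN z : abs (- z) = abs z.
Proof. by apply: (fmorph_inj inj); rewrite -!normE normrN. Qed.

Lemma modulusBC z w : abs (z - w) = abs (w - z).
Proof. by rewrite -modulusN opprB. Qed.

Lemma modulus_cj z : abs (cj z) = abs z.
Proof.
have [->|z0] := eqVneq z 0; first by rewrite rmorph0.
apply: (fmorph_inj inj); rewrite -!normE.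
by apply: (mulfI (_ : `|z| != 0)); rewrite ?normr_eq0// -normrM mul_cj normrX normr_id.
Qed.

(** Convergence is read on real moduli, so that squeezing and monotone limits in [R] apply to both
    scalar fields. *)
Definition tendsto (w : nat -> K) (l : K) : Prop :=
  abs (w n - l) @[n --> \oo] --> (0 : R).

Lemma tendsto_le (w : nat -> K) l (r : nat -> R) :
  (forall n, abs (w n - l) <= r n) -> r n @[n --> \oo] --> 0 -> tendsto w l.
Proof.
move=> wr r0; apply: (@squeeze_cvgr _ _ _ _ (fun=> 0) r) => //.
- by apply: nearW => n; rewrite modulus_ge0 wr.
- exact: cvg_cst.
Qed.

Lemma tendsto_uniq w l m : tendsto w l -> tendsto w m -> l = m.
Proof.
move=> wl wm; apply/eqP; rewrite -subr_eq0; apply/eqP/modulus_eq0.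
have : tendsto (fun=> l) m.
  apply: tendsto_le (_ : (abs (w n - l) + abs (w n - m)) @[n --> \oo] --> 0).
    move=> n; rewrite (_ : l - m = (l - w n) + (w n - m)); last by ring.
    by rewrite (le_trans (ler_modulusD _ _))// lerD2r modulusBC.
  by rewrite -(addr0 0); exact: cvgD.
by move=> lm; apply: (cvg_unique (@Rhausdorff R) _ lm); exact: cvg_cst.
Qed.

Lemma tendstoD u v l m : tendsto u l -> tendsto v m ->
  tendsto (fun n => u n + v n) (l + m).
Proof.
move=> ul vm; apply: tendsto_le (_ : (abs (u n - l) + abs (v n - m)) @[n --> \oo] --> 0).
  by move=> n; rewrite opprD addrACA ler_modulusD.
by rewrite -(addr0 0); exact: cvgD.
Qed.

Lemma tendstoZ c u l : tendsto u l -> tendsto (fun n => c * u n) (c * l).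
Proof.
move=> ul; apply: tendsto_le (_ : (abs c * abs (u n - l)) @[n --> \oo] --> 0).
  by move=> n; rewrite -mulrBr modulusM.
by rewrite -(mulr0 (abs c)); apply: cvgMr.
Qed.

Lemma tendsto_cj u l : tendsto u l -> tendsto (fun n => cj (u n)) (cj l).
Proof.
by move=> ul; apply: tendsto_le ul => n; rewrite -rmorphB modulus_cj.
Qed.

Lemma tendsto_inj (r : nat -> R) a :
  r n @[n --> \oo] --> a -> tendsto (fun n => inj (r n)) (inj a).
Proof.
move=> ra; apply: tendsto_le (_ : `|r n - a| @[n --> \oo] --> 0).
  by move=> n; rewrite -rmorphB modulus_inj.
by rewrite -(normr0 R) -(subrr a); apply: cvg_norm; apply: cvgB => //; exact: cvg_cst.
Qed.

(** The partial sums of moduli increase to a finite limit, and their increments dominate those of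
    the series, which is therefore Cauchy. *)
Lemma summable_tendsto (F : nat -> K) (M : R) :
    (forall n, \sum_(i < n) abs (F i) <= M) ->
  exists l, tendsto (fun n => \sum_(i < n) F i) l.
Proof.
move=> FM; apply: scalars_complete => e e0.
pose r n := \sum_(i < n) abs (F i).
have rcvg : r n @[n --> \oo] --> sup (range r).
  apply: nondecreasing_cvgn.
    apply/nondecreasing_seqP => n.
    by rewrite /r big_ord_recr lerDl modulus_ge0.
  by exists M => _ [n _ <-]; exact: FM.
have e20 : 0 < e / 2 by lra.
have /cvgrPdist_le/(_ _ e20)[N _ rN] := rcvg.
have diff m n : (m <= n)%N ->
    abs (\sum_(i < n) F i - \sum_(i < m) F i) <= r n - r m.
  elim: n => [|n IH].
    by rewrite leqn0 => /eqP ->; rewrite !subrr modulus0.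
  rewrite leq_eqVlt => /predU1P[->|]; first by rewrite !subrr modulus0.
  rewrite ltnS => /IH {}IH; rewrite /r !big_ord_recr/= -/(r n) addrAC.
  by rewrite (le_trans (ler_modulusD _ _))// addrAC lerD2r.
exists N => m n Nm Nn; wlog mn : m n Nm Nn / (m <= n)%N.
  by move=> W; have [/W->|/ltnW/W] := leqP m n => //; rewrite modulusBC; apply.
rewrite modulusBC (le_trans (diff _ _ mn))//.
by have /ler_normlP[] := rN m Nm; have /ler_normlP[] := rN n Nn; lra.
Qed.

End Scalars.

(** * Euclidean norms of truncated sequences *)

(** Minkowski in the plane, from Cauchy-Schwarz, itself given by Lagrange's identity. It is the
    induction step of [ler_trunc_normD], where a truncation of length [n.+1] has the norm of the
    pair [(p n u, abs (u n))]. *)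
Lemma sqrt_sqrD_triangle (R : realType) (a b c d : R) :
  Num.sqrt ((a + b) ^+ 2 + (c + d) ^+ 2) <=
  Num.sqrt (a ^+ 2 + c ^+ 2) + Num.sqrt (b ^+ 2 + d ^+ 2).
Proof.
set X := Num.sqrt (a ^+ 2 + c ^+ 2); set Y := Num.sqrt (b ^+ 2 + d ^+ 2).
have XE : X ^+ 2 = a ^+ 2 + c ^+ 2 by rewrite sqr_sqrtr ?addr_ge0 ?sqr_ge0.
have YE : Y ^+ 2 = b ^+ 2 + d ^+ 2 by rewrite sqr_sqrtr ?addr_ge0 ?sqr_ge0.
have X0 : 0 <= X := sqrtr_ge0 _.
have Y0 : 0 <= Y := sqrtr_ge0 _.
have XY : a * b + c * d <= X * Y.
  rewrite (le_trans (ler_norm _))// -sqrtr_sqr.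
  have -> : X * Y = Num.sqrt ((X * Y) ^+ 2) by rewrite sqrtr_sqr ger0_norm// mulr_ge0.
  rewrite ler_wsqrtr// exprMn XE YE -subr_ge0.
  rewrite (_ : _ - _ = (a * d - b * c) ^+ 2) ?sqr_ge0//; ring.
rewrite -[leRHS]ger0_norm ?addr_ge0// -sqrtr_sqr ler_wsqrtr//.
rewrite (sqrrD X) XE YE; lra.
Qed.

Section Truncations.
Variables (R : realType) (K : numFieldType) (s : scalars R K).
Local Notation inj := (embed s).
Local Notation abs := (modulus s).

Definition trunc_norm (n : nat) (u : nat -> K^o) : R :=
  Num.sqrt (\sum_(i < n) abs (u i) ^+ 2).
Local Notation p := trunc_norm.

Lemma sqr_trunc_norm n u : p n u ^+ 2 = \sum_(i < n) abs (u i) ^+ 2.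
Proof. by rewrite sqr_sqrtr// sumr_ge0// => i _; rewrite sqr_ge0. Qed.

Lemma trunc_norm_ge0 n u : 0 <= p n u.
Proof. exact: sqrtr_ge0. Qed.

Lemma trunc_normS n u : p n.+1 u = Num.sqrt (p n u ^+ 2 + abs (u n) ^+ 2).
Proof. by rewrite sqr_trunc_norm /trunc_norm big_ord_recr. Qed.

Lemma ler_trunc_normD n u v : p n (u + v) <= p n u + p n v.
Proof.
elim: n => [|n IH]; first by rewrite /trunc_norm !big_ord0 sqrtr0 addr0.
rewrite !trunc_normS; apply: le_trans (sqrt_sqrD_triangle _ _ _ _).
rewrite ler_wsqrtr// lerD// lerXn2r ?nnegrE ?addr_ge0 ?trunc_norm_ge0 ?modulus_ge0//.
exact: ler_modulusD.
Qed.

Lemma trunc_normZ n c u : p n (c *: u) = abs c * p n u.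
Proof.
rewrite /trunc_norm -(ger0_norm (modulus_ge0 s c)) -sqrtr_sqr -sqrtrM ?sqr_ge0//.
by rewrite mulr_sumr; congr Num.sqrt; apply: eq_bigr => i _; rewrite -exprMn -modulusM.
Qed.

Lemma trunc_normN n u : p n (- u) = p n u.
Proof.
by rewrite -scaleN1r trunc_normZ modulusN -(rmorph1 inj) modulus_inj normr1 mul1r.
Qed.

Lemma trunc_norm_distC n u v : p n (u - v) = p n (v - u).
Proof. by rewrite -trunc_normN opprB. Qed.

Lemma ler_trunc_norm_dist n v u w : p n (u - w) <= p n (u - v) + p n (v - w).
Proof. by rewrite (le_trans _ (ler_trunc_normD _ _ _))// addrA subrK. Qed.

Lemma nondecreasing_trunc_norm u : nondecreasing_seq (p ^~ u).
Proof.
apply/nondecreasing_seqP => n; rewrite trunc_normS.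
rewrite -[leLHS]ger0_norm ?trunc_norm_ge0// -sqrtr_sqr ler_wsqrtr//.
by rewrite lerDl sqr_ge0.
Qed.

Lemma modulus_le_trunc_norm u i : abs (u i) <= p i.+1 u.
Proof.
rewrite trunc_normS -[leLHS]ger0_norm ?modulus_ge0// -sqrtr_sqr ler_wsqrtr//.
by rewrite lerDr sqr_ge0.
Qed.

Lemma trunc_norm_le_sum n u : p n u <= \sum_(i < n) abs (u i).
Proof.
elim: n => [|n IH]; first by rewrite /trunc_norm !big_ord0 sqrtr0.
rewrite trunc_normS big_ord_recr/=.
apply: le_trans (_ : p n u + abs (u n) <= _); last first.
  by rewrite lerD2r.
rewrite -[leRHS]ger0_norm ?addr_ge0 ?trunc_norm_ge0 ?modulus_ge0//.
rewrite -sqrtr_sqr ler_wsqrtr// sqrrD.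
have : 0 <= p n u * abs (u n) by rewrite mulr_ge0 ?trunc_norm_ge0 ?modulus_ge0.
lra.
Qed.

End Truncations.

(** The bound may depend on [x]: it only says that the values lie in l^2. Continuity enters later,
    in [to_closure_continuous]. *)
Record l2_map (R : realType) (K : numFieldType) (s : scalars R K)
    (B : lmodType K) := L2Map {
  l2_linear :> {linear B -> (nat -> K^o)};
  l2_bounded : forall x, exists M, forall n, trunc_norm s n (l2_linear x) <= M }.

(** * The closure of the range as a normed space *)

Section RangeClosure.
Variables (R : realType) (K : numFieldType) (s : scalars R K).
Variables (B : lmodType K) (T : l2_map s B).
Local Notation inj := (embed s).
Local Notation abs := (modulus s).
Local Notation p := (trunc_norm s).

(** A bound uniform in [n] says that [u - T x] is in l^2 with norm at most [e]. Hence [u] itself is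
    in l^2, as [T x] is. *)
Definition in_l2_closure : {pred (nat -> K^o)} := fun u =>
  `[< forall e : R, 0 < e -> exists x, forall n, p n (u - T x) <= e >].

Lemma in_l2_closure_submod : submod_closed in_l2_closure.
Proof.
split=> [|a u v /asboolP uc /asboolP vc]; apply/asboolP => e e0.
  by exists 0 => n; rewrite linear0 subrr -(scale0r 0) trunc_normZ modulus0 mul0r ltW.
(* Adding 1 keeps the divisor nonzero when [a = 0]. *)
have a1 : 0 < abs a + 1 by have := modulus_ge0 s a; lra.
have e20 : 0 < e / 2 by lra.
have [x xu] := uc _ (divr_gt0 e20 a1).
have [y yv] := vc _ e20.
exists (a *: x + y) => n; rewrite linearP opprD addrACA -scalerBr.
rewrite (le_trans (ler_trunc_normD _ _ _ _))// trunc_normZ.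
have : abs a * p n (u - T x) <= (abs a + 1) * (e / 2 / (abs a + 1)).
  by apply: ler_pM => //; rewrite ?modulus_ge0 ?trunc_norm_ge0//; lra.
rewrite [leRHS]mulrC divfK ?gt_eqF//.
have := yv n; lra.
Qed.

HB.instance Definition _ := GRing.isSubmodClosed.Build K (nat -> K^o)
  in_l2_closure in_l2_closure_submod.

Record l2_closure := L2Closure { l2_val :> nat -> K^o; _ : in_l2_closure l2_val }.

HB.instance Definition _ := [isSub for l2_val].
HB.instance Definition _ := [Choice of l2_closure by <:].
HB.instance Definition _ := [SubChoice_isSubLmodule of l2_closure by <:].

Implicit Types u v : l2_closure.

Lemma l2_closureP u (e : R) : 0 < e -> exists x, forall n, p n (l2_val u - T x) <= e.
Proof. by case: u => u /= /asboolP; apply. Qed.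

Lemma l2_closure_bounded u : has_ubound (range (p ^~ u)).
Proof.
have [x ux] := l2_closureP u ltr01.
have [M TM] := l2_bounded T x.
exists (1 + M) => _ [n _ <-].
by rewrite -(subrK (T x) (u : nat -> K^o)) (le_trans (ler_trunc_normD _ _ _ _))// lerD.
Qed.

Definition l2_norm u : R := sup (range (p ^~ u)).

Lemma trunc_norm_le_l2 n u : p n u <= l2_norm u.
Proof. by apply: ub_le_sup; [exact: l2_closure_bounded|exists n]. Qed.

Lemma l2_norm_le u M : (forall n, p n u <= M) -> l2_norm u <= M.
Proof.
move=> uM; apply: ge_sup; first by exists (p 0%N u), 0%N.
by move=> _ [n _ <-].
Qed.

Lemma trunc_norm_cvg u : p n u @[n --> \oo] --> l2_norm u.
Proof.
apply: nondecreasing_cvgn; first exact: nondecreasing_trunc_norm.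
exact: l2_closure_bounded.
Qed.

Lemma l2_norm_ge0 u : 0 <= l2_norm u.
Proof. exact: le_trans (trunc_norm_ge0 s 0 u) (trunc_norm_le_l2 0 u). Qed.

Lemma l2_norm_triangle u v : inj (l2_norm (u + v)) <= inj (l2_norm u) + inj (l2_norm v).
Proof.
rewrite -rmorphD ler_inj; apply: l2_norm_le => n.
rewrite (le_trans (ler_trunc_normD _ _ _ _))//.
by rewrite lerD ?trunc_norm_le_l2.
Qed.

Lemma l2_normZ (c : K) u : inj (l2_norm (c *: u)) = `|c| * inj (l2_norm u).
Proof.
rewrite (norm_modulus s) -rmorphM; congr (embed s _).
have := @trunc_norm_cvg (c *: u).
under eq_cvg do rewrite (trunc_normZ s _ c u).
move=> /(cvg_unique (@Rhausdorff R)); apply.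
by apply: cvgMr; exact: trunc_norm_cvg.
Qed.

Lemma l2_norm_eq0 u : inj (l2_norm u) = 0 -> u = 0.
Proof.
move=> /eqP; rewrite fmorph_eq0 => /eqP u0.
apply: val_inj; apply/funext => i; apply: (@modulus_eq0 _ _ s).
apply/eqP; rewrite eq_le modulus_ge0 andbT -u0.
exact: le_trans (modulus_le_trunc_norm s u i) (trunc_norm_le_l2 _ _).
Qed.

HB.instance Definition _ := Lmodule_isNormed.Build K l2_closure
  l2_norm_triangle l2_normZ l2_norm_eq0.

Lemma l2_closure_normE u : `|u| = inj (l2_norm u).
Proof. by []. Qed.

End RangeClosure.

(** * Completeness and inner product of the closure *)

Section ClosureHilbert.
Variables (R : realType) (K : numFieldType) (s : scalars R K).
Variables (B : lmodType K) (T : l2_map s B).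
Local Notation inj := (embed s).
Local Notation abs := (modulus s).
Local Notation cj := (cj s).
Local Notation p := (trunc_norm s).
Local Notation H := (l2_closure T).

Lemma invnS_le (e : R) : 0 < e -> exists N, forall k, (N <= k)%N -> k.+1%:R^-1 <= e.
Proof.
move=> e0; have [N _ Ne] := near_infty_natSinv_lt (PosNum e0).
by exists N => k Nk; exact/ltW/Ne.
Qed.

Lemma trunc_norm_tendsto0 n (x : nat -> H) (u : nat -> K^o) :
    (forall i, tendsto s (fun k => x k i) (u i)) ->
  p n ((x k : nat -> K^o) - u) @[k --> \oo] --> (0 : R).
Proof.
move=> xu; have S0 : \sum_(i < n) abs (x k i - u i) @[k --> \oo] --> (0 : R).
  elim: n => [|n IH]; first by under eq_cvg do rewrite big_ord0; exact: cvg_cst.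
  under eq_cvg do rewrite big_ord_recr/=.
  by have := cvgD IH (xu n); rewrite addr0; apply.
apply: (@squeeze_cvgr _ _ _ _ (fun=> 0) _ _ _ _ _ S0); last exact: cvg_cst.
by apply: nearW => k; rewrite trunc_norm_ge0/= trunc_norm_le_sum.
Qed.

(** Centers of balls of radius [1 / (k + 1)] belonging to [F] form a Cauchy sequence. Its
    coordinatewise limit is close to the centers uniformly in the truncation length, so it lies in
    the closure and is the limit of [F]. *)
Lemma l2_closure_complete (F : set_system H) :
  ProperFilter F -> cauchy F -> cvg F.
Proof.
move=> FF /cauchyP Fc.
have /choice[x Fx] k : exists x : H, F (ball x (inj (k.+1%:R^-1))).
  by apply: Fc; rewrite -(rmorph0 inj) ltr_inj invr_gt0.
have ballP k (y : H) n : ball (x k) (inj (k.+1%:R^-1)) y ->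
    p n ((x k : nat -> K^o) - (y : nat -> K^o)) <= k.+1%:R^-1.
  rewrite -ball_normE/= l2_closure_normE ltr_inj => /ltW xy.
  exact: le_trans (trunc_norm_le_l2 n (x k - y)) xy.
(* Two balls belonging to a proper filter meet. *)
have xx k l n : p n ((x k : nat -> K^o) - (x l : nat -> K^o)) <= k.+1%:R^-1 + l.+1%:R^-1.
  have [y [/ballP ky /ballP ly]] := filter_ex (filterI (Fx k) (Fx l)).
  rewrite (le_trans (ler_trunc_norm_dist _ _ (y : nat -> K^o) _ _))// lerD//.
  by rewrite trunc_norm_distC.
have /choice[u xu] i : exists l, tendsto s (fun k => x k i) l.
  apply: scalars_complete => e e0.
  have [N Ne] := invnS_le (divr_gt0 e0 (ltr0Sn _ 1)).
  exists N => m n Nm Nn.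
  have := modulus_le_trunc_norm s ((x m : nat -> K^o) - (x n : nat -> K^o)) i.
  move=> /le_trans; apply.
  rewrite (le_trans (xx _ _ _))//.
  by rewrite (splitr e) lerD// Ne.
(* Let [l] tend to infinity in [xx] with [n] fixed: only finitely many coordinates are involved, so
   coordinatewise convergence is enough. *)
have xku k n : p n ((x k : nat -> K^o) - u) <= k.+1%:R^-1.
  apply/ler_addgt0Pr => e e0; have e20 : 0 < e / 2 by lra.
  have [N Ne] := invnS_le e20.
  have /cvgrPdist_le/(_ _ e20)[M _ MP] := trunc_norm_tendsto0 n xu.
  pose l := maxn N M.
  rewrite (le_trans (ler_trunc_norm_dist _ _ (x l : nat -> K^o) _ _))//.
  have Pl : p n ((x l : nat -> K^o) - u) <= e / 2.
    have := MP l (leq_maxr _ _).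
    by rewrite sub0r normrN ger0_norm ?trunc_norm_ge0.
  apply: le_trans (lerD (xx k l n) Pl) _.
  by rewrite -addrA lerD2l [leRHS]splitr lerD2r Ne ?leq_maxl.
have uc : in_l2_closure T u.
  apply/asboolP => e e0; have e20 : 0 < e / 2 by lra.
  have [N /(_ _ (leqnn _)) Ne] := invnS_le e20.
  have [y yx] := l2_closureP (x N) e20.
  exists y => n; rewrite (le_trans (ler_trunc_norm_dist _ _ (x N : nat -> K^o) _ _))//.
  by rewrite trunc_norm_distC [leRHS]splitr (lerD (le_trans (xku N n) Ne) (yx n)).
apply/cvg_ex; exists (L2Closure uc); apply/fcvg_ballP => e e0.
have eE : e = inj (abs e) by rewrite -norm_modulus ger0_norm// ltW.
have r0 : 0 < abs e by rewrite -(ltr_inj s) rmorph0 -eE.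
have [N /(_ _ (leqnn _)) Ne] := invnS_le (divr_gt0 r0 (ltr0Sn _ 2)).
apply: filterS (Fx N) => y /ballP xy.
rewrite -ball_normE/= l2_closure_normE eE ltr_inj.
(* A supremum of truncations gives only a weak inequality; two thirds of the radius leave room for
   the strict one. *)
apply: (@le_lt_trans _ _ (abs e / 3 + abs e / 3)); last by lra.
apply: l2_norm_le => n /=.
rewrite (le_trans (ler_trunc_norm_dist _ _ (x N : nat -> K^o) _ _))// lerD//.
  by rewrite trunc_norm_distC (le_trans (xku _ _)).
by rewrite (le_trans (xy n)).
Qed.

HB.instance Definition _ := Uniform_isComplete.Build H l2_closure_complete.

(** Absolute convergence, by [a * b <= a^2 + b^2] applied to the moduli of the coordinates. *)
Lemma l2_dot_cvg (u v : H) : exists l, tendsto s (fun n => \sum_(i < n) u i * cj (v i)) l.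
Proof.
apply: (@summable_tendsto _ _ _ (fun i => u i * cj (v i))
  (l2_norm u ^+ 2 + l2_norm v ^+ 2)) => n.
have sq (w : H) : \sum_(i < n) abs (w i) ^+ 2 <= l2_norm w ^+ 2.
  by rewrite -sqr_trunc_norm lerXn2r ?nnegrE ?trunc_norm_ge0 ?l2_norm_ge0//
    trunc_norm_le_l2.
apply: le_trans (lerD (sq u) (sq v)); rewrite -big_split/=; apply: ler_sum => i _.
rewrite modulusM modulus_cj.
have := sqr_ge0 (abs (u i) - abs (v i)); have := sqr_ge0 (abs (u i) + abs (v i)).
by rewrite sqrrB sqrrD; lra.
Qed.

(** A chosen limit; each identity below is checked on partial sums and passes to it by
    [tendsto_uniq]. *)
Definition l2_dot (u v : H) : K := sval (cid (l2_dot_cvg u v)).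

Lemma l2_dotP (u v : H) : tendsto s (fun n => \sum_(i < n) u i * cj (v i)) (l2_dot u v).
Proof. exact: svalP (cid (l2_dot_cvg u v)). Qed.

Lemma l2_dot_hermitian (u v : H) : l2_dot u v = (-1) ^+ false * cj (l2_dot v u).
Proof.
rewrite expr0 mul1r; apply: tendsto_uniq (l2_dotP u v) _.
have := tendsto_cj (l2_dotP v u); congr tendsto; apply/funext => n.
by rewrite rmorph_sum; apply: eq_bigr => i _; rewrite rmorphM/= cjK mulrC.
Qed.

Lemma l2_dot_linearl (w : H) : GRing.linear_for *%R (l2_dot ^~ w).
Proof.
move=> a u v; apply: tendsto_uniq (l2_dotP _ w) _.
have := tendstoD (tendstoZ a (l2_dotP u w)) (l2_dotP v w).
congr tendsto; apply/funext => n; rewrite mulr_sumr -big_split/=.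
by apply: eq_bigr => i _; rewrite mulrDl mulrA.
Qed.

Lemma l2_dot_linearr (w : H) : GRing.linear_for (cj \; *%R) (l2_dot w).
Proof.
move=> a u v; rewrite l2_dot_hermitian l2_dot_linearl mul1r rmorphD rmorphM/=.
by rewrite (l2_dot_hermitian w u) (l2_dot_hermitian w v) !mul1r.
Qed.

Lemma l2_dot_norm (u : H) : `|u| ^+ 2 = l2_dot u u.
Proof.
rewrite l2_closure_normE; apply: tendsto_uniq (_ : tendsto s _ _) (l2_dotP u u).
have pu : p n u ^+ 2 @[n --> \oo] --> l2_norm u ^+ 2.
  by rewrite expr2; under eq_cvg do rewrite expr2; apply: cvgM; exact: trunc_norm_cvg.
have := tendsto_inj s pu; rewrite rmorphXn; congr tendsto; apply/funext => n.
rewrite sqr_trunc_norm rmorph_sum; apply: eq_bigr => i _.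
by rewrite rmorphXn/= -norm_modulus mul_cj.
Qed.

HB.instance Definition _ := bilinear_isBilinear.Build K H H K *%R (cj \; *%R) l2_dot
  (l2_dot_linearl, l2_dot_linearr).

HB.instance Definition _ := isHermitianSesquilinear.Build K H false cj l2_dot
  l2_dot_hermitian.

Lemma l2_dot_gt0 (u : H) : u != 0 -> 0 < l2_dot u u.
Proof. by move=> u0; rewrite -l2_dot_norm exprn_gt0// normr_gt0. Qed.

HB.instance Definition _ := isDotProduct.Build K H l2_dot l2_dot_gt0.

Lemma l2_closure_hilbert : is_hilbert cj (l2_closure T : completeNormedModType K).
Proof. by exists (l2_dot : {dot H for cj}) => u; exact: l2_dot_norm. Qed.

End ClosureHilbert.

(** * Norming functionals and the weighted map *)

Section NormingFunctionals.
Variables (R : realType) (K : numFieldType) (s : scalars R K).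
Variable B : normedModType K.
Local Notation inj := (embed s).
Local Notation abs := (modulus s).
Implicit Types x y : B.

Definition real_norm x : R := abs `|x|.

Lemma real_normE x : `|x| = inj (real_norm x).
Proof. by rewrite -norm_modulus normr_id. Qed.

Lemma real_norm_ge0 x : 0 <= real_norm x.
Proof. exact: modulus_ge0. Qed.

Lemma ler_real_normD x y : real_norm (x + y) <= real_norm x + real_norm y.
Proof. by rewrite -(ler_inj s) rmorphD/= -!real_normE ler_normD. Qed.

Lemma real_normZ (c : K) x : real_norm (c *: x) = abs c * real_norm x.
Proof.
rewrite /real_norm normrZ modulusM (norm_modulus s c).
by rewrite modulus_inj ger0_norm ?modulus_ge0.
Qed.

Lemma norming_functional x : exists f : {linear B -> K^o},
  real_norm x <= abs (f x) /\ forall y, abs (f y) <= 2 * real_norm y.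
Proof.
have nsub : sublinear inj real_norm.
  split=> [y z|t y t0]; first exact: ler_real_normD.
  by rewrite real_normZ modulus_inj ger0_norm.
have [g [gD gZ gle gx]] := hahn_banach x nsub.
have gN y : g (- y) = - g y by have := gZ (-1) y; rewrite rmorphN1 scaleN1r mulN1r.
have gabs y : `|g y| <= real_norm y.
  rewrite ler_norml gle andbT lerNl -gN (le_trans (gle _))//.
  by rewrite /real_norm normrN.
have [f fg] := real_functional_lift gD gZ.
exists f; split=> [|y].
  by have /andP[] := fg x; rewrite gx ger0_norm ?real_norm_ge0.
have /andP[_ /le_trans] := fg y; apply; rewrite mulr2n mulrDl mul1r lerD//.
by rewrite (le_trans (gabs _))// real_normZ modulus_unit_i mul1r.
Qed.

(** Norming at dense points is enough: if all [f n] vanish at [x] and [f] norms a nearby [d], then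
    [|d| <= |f d| = |f (x - d)| <= 2 |x - d|], so [|x| <= 3 |x - d|]. *)
Lemma separating_sequence : separable_space B ->
  exists f : nat -> {linear B -> K^o},
    (forall n y, abs (f n y) <= 2 * real_norm y) /\
    (forall x, (forall n, f n x = 0) -> x = 0).
Proof.
move=> [D /countable_injP[e einj] Ddense].
have /choice[f fP] n : exists f : {linear B -> K^o},
    (forall y, abs (f y) <= 2 * real_norm y) /\
    (forall d, D d -> e d = n -> real_norm d <= abs (f d)).
  have [[d [Dd dn]]|nd] := pselect (exists d, D d /\ e d = n).
    have [f [fd fle]] := norming_functional d.
    exists f; split=> // c Dc cn; suff -> : c = d by [].
    by apply: einj; rewrite ?inE// cn.
  (* An index that codes no point of [D] gets the zero functional. *)
  exists (\0 : {linear B -> K^o}); split=> [y|d Dd dn].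
    by rewrite modulus0 mulr_ge0// real_norm_ge0.
  by exfalso; apply: nd; exists d.
exists f; split=> [n|x fx0]; first exact: (fP n).1.
apply/normr0_eq0; rewrite real_normE; apply/eqP; rewrite fmorph_eq0.
rewrite eq_le real_norm_ge0 andbT; apply/ler_addgt0Pl => r r0.
have r3 : 0 < r / 3 by lra.
have injr : 0 < inj (r / 3) by rewrite -(rmorph0 inj) ltr_inj.
have [d [xd Dd]] : ball x (inj (r / 3)) `&` D !=set0.
  by apply: Ddense; [exists x; exact: ballxx|exact: ball_open].
have {}xd : real_norm (x - d) <= r / 3.
  by move: xd; rewrite -ball_normE/= real_normE ltr_inj => /ltW.
have dle : real_norm d <= 2 * real_norm (x - d).
  rewrite (le_trans ((fP (e d)).2 d Dd erefl))// (le_trans _ ((fP (e d)).1 _))//.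
  by rewrite linearB/= fx0 sub0r modulusN.
have := ler_real_normD (x - d) d; rewrite subrK; lra.
Qed.

Definition weighted (f : nat -> {linear B -> K^o}) (x : B) : nat -> K^o :=
  fun n => inj (2^-1 ^+ n) *: f n x.

Lemma weighted_linear f : linear (weighted f).
Proof.
move=> c x y; apply/funext => n; rewrite /weighted linearP scalerDr.
by rewrite scalerA mulrC -scalerA.
Qed.

HB.instance Definition _ f := GRing.isLinear.Build K B (nat -> K^o) _
  (weighted f) (weighted_linear f).

(** The l^2 norm is at most the l^1 norm; the constant 4 is the bound 2 on the functionals times the
    sum 2 of the weights. *)
Lemma trunc_norm_weighted (f : nat -> {linear B -> K^o}) n x :
  (forall n y, abs (f n y) <= 2 * real_norm y) ->
  trunc_norm s n (weighted f x) <= 4 * real_norm x.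
Proof.
move=> fle; rewrite (le_trans (trunc_norm_le_sum _ _ _))//.
have n0 := real_norm_ge0 x.
have pw m : 0 <= (2^-1 : R) ^+ m by rewrite exprn_ge0// invr_ge0.
apply: (@le_trans _ _ (\sum_(i < n) 2^-1 ^+ i * (2 * real_norm x))).
  apply: ler_sum => i _; rewrite /weighted modulusM modulus_inj ger0_norm//.
  by rewrite ler_wpM2l.
rewrite -mulr_suml.
have -> : \sum_(i < n) (2^-1 : R) ^+ i = 2 - 2 * 2^-1 ^+ n.
  elim: n => [|n IH]; first by rewrite big_ord0 expr0; lra.
  by rewrite big_ord_recr/= IH exprS; lra.
have := mulr_ge0 (pw n) n0; lra.
Qed.

End NormingFunctionals.

(** * The embedding into the closure *)

Section Embedding.
Variables (R : realType) (K : numFieldType) (s : scalars R K).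
Variables (B : normedModType K) (T : l2_map s B).
Local Notation H := (l2_closure T).

Lemma l2_map_in_closure x : in_l2_closure T (T x).
Proof.
apply/asboolP => e e0; exists x => n.
by rewrite subrr -(scale0r 0) trunc_normZ modulus0 mul0r ltW.
Qed.

Definition to_closure (x : B) : H := L2Closure (l2_map_in_closure x).

Lemma to_closure_linear : linear to_closure.
Proof. by move=> c x y; apply: val_inj; rewrite /= linearP. Qed.

HB.instance Definition _ := GRing.isLinear.Build K B H _
  to_closure to_closure_linear.

Lemma to_closure_dense : dense (range to_closure).
Proof.
move=> O [u Ou] Oopen; have /nbhs_ballP[e e0 eO] : nbhs u O by exact: open_nbhs_nbhs.
have eE : e = embed s (modulus s e) by rewrite -norm_modulus ger0_norm// ltW.
have r0 : 0 < modulus s e by rewrite -(ltr_inj s) rmorph0 -eE.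
have r20 : 0 < modulus s e / 2 by lra.
have [x ux] := l2_closureP u r20.
exists (to_closure x); split; last by exists x.
apply: eO; rewrite -ball_normE/= l2_closure_normE eE ltr_inj.
apply: (@le_lt_trans _ _ (modulus s e / 2)); last by lra.
by apply: l2_norm_le => n; exact: ux.
Qed.

(** The map is Lipschitz with constant [M], by linearity. *)
Lemma to_closure_continuous (M : R) : 0 < M ->
  (forall n x, trunc_norm s n (T x) <= M * real_norm s x) -> continuous to_closure.
Proof.
move=> M0 TM x; apply/cvgrPdist_le => e e0.
have iM : 0 < embed s M by rewrite -(rmorph0 (embed s)) ltr_inj.
near=> y; rewrite -linearB/= l2_closure_normE.
apply: (@le_trans _ _ (embed s M * `|x - y|)).
  rewrite (real_normE s) -rmorphM ler_inj; apply: l2_norm_le => n; exact: TM.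
rewrite mulrC -ler_pdivlMr//; near: y.
by apply: cvgr_dist_le; [exact: cvg_id|rewrite divr_gt0].
Unshelve. all: by end_near. Qed.

Lemma to_closure_injective : (forall x, T x = 0 -> x = 0) -> injective to_closure.
Proof.
move=> T0 x y /(congr1 val)/= Txy; apply/eqP; rewrite -subr_eq0; apply/eqP/T0.
by rewrite linearB/= Txy subrr.
Qed.

End Embedding.

Lemma separable_dense_range (X Y : topologicalType) (f : X -> Y) :
  continuous f -> dense (range f) -> separable_space X -> separable_space Y.
Proof.
move=> fc fd [D Dc Dd]; exists (f @` D).
  exact: sub_countable (card_image_le _ _) Dc.
move=> O O0 Oo; have [y [Oy [x _ xy]]] := fd O O0 Oo.
have [z [Oz Dz]] : (f @^-1` O) `&` D !=set0.
  apply: Dd; first by exists x; rewrite /= xy.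
  by apply: open_comp => // z _; exact: fc.
by exists (f z); split => //; exists z.
Qed.

Lemma hilbert_embedding (R : realType) (K : numFieldType) (s : scalars R K)
    (B : completeNormedModType K) : separable_space B ->
  exists H : completeNormedModType K,
    [/\ is_hilbert (cj s) H, separable_space H &
        exists f : {linear B -> H}, continuous_dense_embedding f].
Proof.
move=> Bsep; have [f [fle f0]] := separating_sequence s Bsep.
have wb x : exists M, forall n, trunc_norm s n (weighted s f x) <= M.
  by exists (4 * real_norm s x) => n; exact: trunc_norm_weighted.
pose T : l2_map s B := L2Map wb.
have Jc : continuous (to_closure T).
  by apply: (@to_closure_continuous _ _ _ _ T 4) => // n x; exact: trunc_norm_weighted.
exists (l2_closure T : completeNormedModType K); split.
- exact: l2_closure_hilbert.
- apply: (@separable_dense_range B (l2_closure T) (to_closure T)) => //.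
  exact: to_closure_dense.
exists (to_closure T : {linear B -> l2_closure T}); split => //; last first.
  exact: to_closure_dense.
apply: to_closure_injective => x Tx0; apply: f0 => n.
have := congr1 (fun u => u n) Tx0; rewrite /= /weighted => /eqP.
rewrite scaler_eq0 fmorph_eq0 expf_eq0 invr_eq0 pnatr_eq0 andbF/=.
by move=> /eqP.
Qed.

(** * Real scalars *)

Lemma real_cauchy_complete (R : realType) (w : nat -> R) :
    (forall e, 0 < e -> exists N, forall m n, (N <= m)%N -> (N <= n)%N ->
      `|w m - w n| <= e) ->
  exists l, `|w n - l| @[n --> \oo] --> (0 : R).
Proof.
move=> wc; have /cauchy_cvgP/cvg_ex[l wl] : cauchy (w @ \oo).
  apply/cauchy_exP => e e0; have e20 : 0 < e / 2 by lra.
  have [N NP] := wc _ e20; exists (w N); exists N => // n /= Nn.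
  rewrite -ball_normE/= (le_lt_trans (NP _ _ (leqnn _) Nn))//; lra.
exists l; rewrite -(normr0 R) -(subrr l).
by apply: cvg_norm; apply: cvgB => //; exact: cvg_cst.
Qed.

Lemma real_norm_idfun (R : realType) (z : R) : `|z| = idfun `|z|.
Proof. by []. Qed.

Lemma real_idfun_ge0 (R : realType) (t : R) : (0 <= idfun t) = (0 <= t).
Proof. by []. Qed.

Lemma real_mul_idfun (R : realType) (z : R) : z * idfun z = `|z| ^+ 2.
Proof. by rewrite real_normK ?num_real// expr2. Qed.

Lemma real_functional_linear (R : realType) (V : lmodType R) (g : V -> R) :
    (forall x y, g (x + y) = g x + g y) ->
    (forall t x, g (t *: x) = t * g x) ->
  exists f : {linear V -> R^o}, forall x, `|g x| <= `|f x| <= `|g x| + `|g (1 *: x)|.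
Proof.
move=> gD gZ; have gl : linear (g : V -> R^o) by move=> a x y; rewrite gD gZ.
pose f : {linear V -> R^o} := HB.pack (g : V -> R^o)
  (GRing.isLinear.Build _ _ _ _ (g : V -> R^o) gl).
by exists f => x; rewrite /f/= lexx lerDl normr_ge0.
Qed.

Definition real_scalars (R : realType) : scalars R R :=
  @Scalars R R idfun (@Num.norm R R) idfun 1 (@real_norm_idfun R) (@real_idfun_ge0 R)
    (@real_mul_idfun R) (fun=> erefl) (normr1 R) (@real_cauchy_complete R)
    (@real_functional_linear R).

(** * Complex scalars *)

Section ComplexScalars.
Variable R : realType.
Local Open Scope complex_scope.
Local Notation normc := (@Normc.normc R).
Implicit Types z w : R[i].

Lemma normc_Re z : `|complex.Re z| <= normc z.
Proof. by case: z => a b /=; rewrite -sqrtr_sqr ler_wsqrtr// lerDl sqr_ge0. Qed.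

Lemma normc_Im z : `|complex.Im z| <= normc z.
Proof. by case: z => a b /=; rewrite -sqrtr_sqr ler_wsqrtr// lerDr sqr_ge0. Qed.

Lemma normc_le_ReIm z : normc z <= `|complex.Re z| + `|complex.Im z|.
Proof.
case: z => a b /=; rewrite -[leRHS]ger0_norm ?addr_ge0// -sqrtr_sqr ler_wsqrtr//.
rewrite sqrrD !real_normK ?num_real//.
have : 0 <= `|a| * `|b| by rewrite mulr_ge0.
lra.
Qed.

Lemma complex_norm_normc z : `|z| = (normc z)%:C.
Proof. by []. Qed.

Lemma real_complex_ge0 (t : R) : (0 <= t%:C) = (0 <= t).
Proof. by rewrite lecE/= eqxx. Qed.

Lemma complex_mul_conjc z : z * conjc z = `|z| ^+ 2.
Proof. by rewrite sqr_normc. Qed.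

Lemma normc_i : normc 'i = 1.
Proof. by rewrite /= expr0n/= add0r expr1n sqrtr1. Qed.

Lemma complex_cauchy_complete (w : nat -> R[i]) :
    (forall e, 0 < e -> exists N, forall m n, (N <= m)%N -> (N <= n)%N ->
      normc (w m - w n) <= e) ->
  exists l, normc (w n - l) @[n --> \oo] --> (0 : R).
Proof.
move=> wc.
have [a wa] : exists a, `|complex.Re (w n) - a| @[n --> \oo] --> (0 : R).
  apply: real_cauchy_complete => e /wc[N NP]; exists N => m n Nm Nn.
  by have := le_trans (normc_Re _) (NP m n Nm Nn); rewrite raddfB.
have [b wb] : exists b, `|complex.Im (w n) - b| @[n --> \oo] --> (0 : R).
  apply: real_cauchy_complete => e /wc[N NP]; exists N => m n Nm Nn.
  by have := le_trans (normc_Im _) (NP m n Nm Nn); rewrite raddfB.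
exists (a +i* b).
have wab : `|complex.Re (w n) - a| + `|complex.Im (w n) - b| @[n --> \oo] --> (0 : R).
  by have := cvgD wa wb; rewrite addr0; apply.
apply: (@squeeze_cvgr _ _ _ _ (fun=> 0) _ _ _ _ _ wab); last exact: cvg_cst.
apply: nearW => n; rewrite (le_trans (normr_ge0 _) (normc_Re _))/=.
by apply: le_trans (normc_le_ReIm _) _; rewrite !raddfB.
Qed.

Lemma complex_functional (V : lmodType R[i]) (g : V -> R) :
    (forall x y, g (x + y) = g x + g y) ->
    (forall t x, g (t%:C *: x) = t * g x) ->
  exists f : {linear V -> R[i]^o}, forall x,
    `|g x| <= normc (f x) <= `|g x| + `|g ('i *: x)|.
Proof.
(* The only complex-linear functional with real part [g]: its imaginary part at [x] must be minus
   its real part at [i x]. *)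
move=> gD gZ; pose h (x : V) : R[i]^o := g x +i* (- g ('i *: x)).
have gC a b x : g ((a +i* b) *: x) = a * g x + b * g ('i *: x).
  rewrite (_ : a +i* b = a%:C + b%:C * 'i); last first.
    by apply/eqP; rewrite eq_complex/=; apply/andP; split; apply/eqP; ring.
  by rewrite scalerDl -scalerA gD !gZ.
have hl : linear h.
  move=> [a b] x y; rewrite /h scalerDr !gD scalerA (gC a b x).
  rewrite (_ : 'i * (a +i* b) = (- b) +i* a); last first.
    by apply/eqP; rewrite eq_complex/=; apply/andP; split; apply/eqP; ring.
  rewrite (gC (- b) a x); move: (g ('i *: x)) (g ('i *: y)) => ix iy.
  by apply/eqP; rewrite /GRing.scale eq_complex/=; apply/andP; split; apply/eqP; ring.
pose f : {linear V -> R[i]^o} := HB.pack h (GRing.isLinear.Build _ _ _ _ h hl).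
exists f => x; rewrite (normc_Re (h x))/=.
by have := normc_le_ReIm (h x); rewrite /= normrN.
Qed.

Definition complex_scalars : scalars R R[i] :=
  @Scalars R R[i] (real_complex R) normc (@conjc R) 'i complex_norm_normc
    real_complex_ge0 complex_mul_conjc (@conjcK R) normc_i
    complex_cauchy_complete complex_functional.

End ComplexScalars.

Theorem theorem2p1 (R : realType) :
  (forall B : completeNormedModType R, separable_space B ->
     exists H : completeNormedModType R,
       [/\ is_hilbert idfun H, separable_space H &
           exists f : {linear B -> H}, continuous_dense_embedding f]) /\
  (forall B : completeNormedModType R[i], separable_space B ->
     exists H : completeNormedModType R[i],
       [/\ is_hilbert (@conjc R) H, separable_space H &
           exists f : {linear B -> H}, continuous_dense_embedding f]).
Proof.
split=> B Bsep.
- exact: (hilbert_embedding (real_scalars R) Bsep).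
- exact: (hilbert_embedding (complex_scalars R) Bsep).
Qed.
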